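(* Let $n$ be a positive integer, $k\in\{1,\dots,n\}$, and let $A,B\colon[0,1]^n\to[0,1]$ be standardized functions with $A\le B$. Suppose that at least one of the functions $A$ and $B$ satisfies Condition S and that $L_k^{(A,B)}(\mathbf R)\ge 0$ for all $\mathbf R\in\mathcal R_k([0,1]^n)$. Then the following are equivalent: (i) for all $\mathbf x\in[0,1]^n$: $P_{\mathrm O,k}^{(A,B)}(\mathbf x)\ge B(\mathbf x)-A(\mathbf x)$; (ii) for all $\mathbf x\in[0,1]^n$: $$B(\mathbf x)=\sup\{C(\mathbf x)\mid C\colon[0,1]^n\to[0,1],\ A\le C\le B,\ C\text{ is a $k$-increasing standardized function}\}.$$
   Context: Write $\mathbb I=[0,1]$; $\le$ between functions is the pointwise order, and ''increasing'' means non-decreasing. Boxes. For $\mathbf x,\mathbf y\in\mathbb I^n$, the product $R=[\mathbf x,\mathbf y]=\prod_{i=1}^n[x_i,y_i]$ is a $k$-box if $x_i<y_i$ for exactly $k$ indices $i$ and $x_i=y_i$ for the remaining $n-k$ indices. Its vertices are $\operatorname{ver}R=\prod_{i=1}^n\{x_i,y_i\}$. The sign of a vertex $\mathbf v$ is $\operatorname{sign}_R(\mathbf v)=(-1)^{m-(n-k)}$, where $m=|\{i: v_i=x_i\}|$. The multiplicity of $\mathbf u\in\mathbb I^n$ with respect to $R$ is $m_R(\mathbf u)=\operatorname{sign}_R(\mathbf u)$ if $\mathbf u\in\operatorname{ver}R$ and $0$ otherwise. $\mathcal R_k(\mathbb I^n)$ is the set of formal finite disjoint unions $\mathbf R=\bigsqcup_{j=1}^s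 R_j$ of $k$-boxes with vertices in $\mathbb I^n$, i.e. finite families (multisets) of $k$-boxes, where repetitions and overlaps are allowed; $m_{\mathbf R}(\mathbf u)=\sum_{j=1}^s m_{R_j}(\mathbf u)$. For functions $A\le B$ on $\mathbb I^n$, $$L_k^{(A,B)}(\mathbf R)=\sum_{\mathbf y:\,m_{\mathbf R}(\mathbf y)>0}m_{\mathbf R}(\mathbf y)B(\mathbf y)+\sum_{\mathbf y:\,m_{\mathbf R}(\mathbf y)<0}m_{\mathbf R}(\mathbf y)A(\mathbf y),\qquad P_{\mathrm O,k}^{(A,B)}(\mathbf x)=\inf_{\substack{\mathbf R\in\mathcal R_k(\mathbb I^n)\\ m_{\mathbf R}(\mathbf x)<0}}\frac{L_k^{(A,B)}(\mathbf R)}{|m_{\mathbf R}(\mathbf x)|},$$ with the convention that the infimum of the empty set equals $0$. Functions. $f\colon\mathbb I^n\to\mathbb I$ is $k$-increasing if $\sum_{\mathbf v\in\operatorname{ver}R}\operatorname{sign}_R(\mathbf v)f(\mathbf v)\ge0$ for every $k$-box $R$ in $\mathbb I^n$ ($1$-increasing means increasing in each variable); grounded if $f(\mathbf x)=0$ whenever some $x_i=0$; standardized if it is grounded, $1$-increasing and $f(1,\dots,1)=1$. Condition S. $f\colon\mathbb I^n\to\mathbb I$ satisfies Condition S if there is a countable set $S\subseteq\mathbb I$ such that for every $\mathbf u\in\mathbb I^n$ and every $i\in\{1,\dots,n\}$ the set of discontinuities of the section $t\mapsto f(u_1,\dots,u_{i-1},t,u_{i+1},\dots,u_n)$ is contained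 in $S$. *)

(* Defs.v *)
From HB Require Import structures.
From mathcomp Require Import all_boot all_order all_algebra.
From mathcomp Require Import all_classical all_reals all_analysis.

Set Implicit Arguments.
Unset Strict Implicit.
Unset Printing Implicit Defensive.

Import Order.TTheory GRing.Theory Num.Theory.
Import numFieldNormedType.Exports.

Local Open Scope classical_set_scope.
Local Open Scope ring_scope.

(* A function on the cube is represented by a total function on 'rV[R]_n; every
   notion below only looks at its values on [cube]. *)
Definition cube (R : realType) (n : nat) : set 'rV[R]_n :=
  [set x | forall i, x 0 i \in `[0, 1]].

Definition unit_valued (R : realType) (n : nat) (f : 'rV[R]_n -> R) : Prop :=
  forall x, cube x -> f x \in `[0, 1].

Definition le_on_cube (R : realType) (n : nat) (f g : 'rV[R]_n -> R) : Prop :=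
  forall x, cube x -> f x <= g x.

(* A box is the pair (x, y) of its lower and upper corners. *)
Definition box (R : realType) (n : nat) : Type := ('rV[R]_n * 'rV[R]_n)%type.

Definition box_dim (R : realType) (n : nat) (b : box R n) : nat :=
  #|[set i : 'I_n | b.1 0 i < b.2 0 i]%SET|.

Definition is_kbox (R : realType) (n k : nat) (b : box R n) : Prop :=
  [/\ cube b.1, cube b.2,
      forall i, b.1 0 i <= b.2 0 i & box_dim b = k].

Definition ver (R : realType) (n : nat) (b : box R n) : set 'rV[R]_n :=
  [set v | forall i, v 0 i = b.1 0 i \/ v 0 i = b.2 0 i].

(* The subtractions are those of nat; they are not truncated when v is a vertex
   of b, since then v agrees with b.1 on all n - box_dim b degenerate
   coordinates. *)
Definition box_sign (R : realType) (n : nat) (b : box R n) (v : 'rV[R]_n) :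
    int :=
  (-1) ^+ (#|[set i : 'I_n | v 0 i == b.1 0 i]%SET| - (n - box_dim b)).

Definition box_mult (R : realType) (n : nat) (b : box R n) (u : 'rV[R]_n) :
    int :=
  if `[< ver b u >] then box_sign b u else 0.

(* Finite multisets of k-boxes are given by listings; [mult] and [Lsum] do not
   depend on the order of the list. *)
Definition kbox_family (R : realType) (n k : nat) : set (seq (box R n)) :=
  [set F | forall b, b \in F -> is_kbox k b].

Definition mult (R : realType) (n : nat) (F : seq (box R n)) (u : 'rV[R]_n) :
    int :=
  \sum_(b <- F) box_mult b u.

Definition Lsum (R : realType) (n : nat) (A B : 'rV[R]_n -> R)
    (F : seq (box R n)) : R :=
  \sum_(y \in [set y | 0 < mult F y]) (mult F y)%:~R * B y +
  \sum_(y \in [set y | mult F y < 0]) (mult F y)%:~R * A y.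

(* [inf set0 = 0] in the library, as required here. As [inf] is real-valued it
   is also 0 on a set unbounded below, but this set is bounded below by 0
   whenever Lsum A B is nonnegative on [kbox_family R n k]. *)
Definition PO (R : realType) (n k : nat) (A B : 'rV[R]_n -> R) (x : 'rV[R]_n) :
    R :=
  inf [set Lsum A B F / `|mult F x|%:~R |
       F in [set F | kbox_family k F /\ mult F x < 0]].

Definition k_increasing (R : realType) (n k : nat) (f : 'rV[R]_n -> R) : Prop :=
  forall b : box R n, is_kbox k b ->
    0 <= \sum_(v \in ver b) (box_sign b v)%:~R * f v.

Definition grounded (R : realType) (n : nat) (f : 'rV[R]_n -> R) : Prop :=
  forall x, cube x -> (exists i, x 0 i = 0) -> f x = 0.

Definition standardized (R : realType) (n : nat) (f : 'rV[R]_n -> R) : Prop :=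
  [/\ unit_valued f, grounded f, k_increasing 1 f & f (const_mx 1) = 1].

Definition set_coord (R : realType) (n : nat) (u : 'rV[R]_n) (i : 'I_n)
    (t : R) : 'rV[R]_n :=
  \row_j (if j == i then t else u 0 j).

(* Continuity of a section at t is relative to [0, 1], hence one-sided at the
   endpoints. *)
Definition conditionS (R : realType) (n : nat) (f : 'rV[R]_n -> R) : Prop :=
  exists S : set R, [/\ countable S, S `<=` `[0, 1] &
    forall (u : 'rV[R]_n) (i : 'I_n), cube u ->
      [set t : R | t \in `[0, 1] /\
         ~ (f (set_coord u i s) @[s --> within `[0, 1] (nbhs t)]
              --> f (set_coord u i t))] `<=` S].

(* Main.v *)
(* L_k^(A,B)(R) is the largest value of sum_y m_R(y) C(y) over the functions C
   with A <= C <= B, so L_k^(A,B) >= 0 holds on all families as soon as a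
   k-increasing C lies between A and B. The converse holds too: by Zorn's lemma
   (A, B) has a minimal refinement (a, b), A <= a <= b <= B, on which the
   functional is still nonnegative, and if a x < b x for some x then a x could
   be raised or b x lowered; hence a = b is k-increasing. Condition (i) at x says
   exactly that the functional stays nonnegative after A x is raised to B x, so
   it yields a k-increasing C between A and B with C x = B x. Such a C is
   1-increasing because it is grounded: a 1-box is thickened to a k-box of the
   same volume by replacing degenerate sides {x_j} by [0, x_j]. *)
Require Import Defs.
From HB Require Import structures.
From mathcomp Require Import all_boot all_order all_algebra.
From mathcomp Require Import all_classical all_reals all_analysis.
From mathcomp Require Import zify lra.

Set Implicit Arguments.
Unset Strict Implicit.
Unset Printing Implicit Defensive.

Import Order.TTheory GRing.Theory Num.Theory.
Import numFieldNormedType.Exports.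

Local Open Scope classical_set_scope.
Local Open Scope ring_scope.

(** * Support function of an interval at an integer multiplicity *)

Section Payoff.
Variable R : realType.
Implicit Types (a b c : R) (z : int).

(** For [a <= b] this is the maximum of [z * c] over [c] in [[a, b]], hence sublinear in [z]. *)
Definition payoff a b z : R := z%:~R * (if 0 < z then b else a).

(** The correction term vanishes unless [z < 0]: only negative multiplicities see the lower end. *)
Lemma payoff_sub a b c z :
  payoff c b z = payoff a b z + payoff (c - a) 0 z.
Proof. by rewrite /payoff; case: ifP => _; rewrite -?mulrDr; congr (_ * _); lra. Qed.

Lemma payoff_sup a b c z :
  payoff a c z = payoff a b z + payoff 0 (c - b) z.
Proof. by rewrite /payoff; case: ifP => _; rewrite -?mulrDr; congr (_ * _); lra. Qed.

Lemma payoff0 a b : payoff a b 0 = 0.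
Proof. by rewrite /payoff mul0r. Qed.

Lemma le_payoff a b a' b' z :
  a <= a' -> b' <= b -> payoff a' b' z <= payoff a b z.
Proof.
move=> aa' bb'; rewrite /payoff; case: ltP => z0.
  by rewrite ler_wpM2l// ler0z ltW.
by rewrite ler_wnM2l// lerz0.
Qed.

Lemma payoff_ge a b c z : a <= c <= b -> z%:~R * c <= payoff a b z.
Proof.
move=> /andP[ac cb].
by apply: le_trans (le_payoff z ac cb); rewrite /payoff if_same.
Qed.

(** The endpoint realising the payoff at [z1 + z2] is a competitor in the maximum for [z1] and in
    that for [z2]. *)
Lemma payoffD a b z1 z2 : a <= b ->
  payoff a b (z1 + z2) <= payoff a b z1 + payoff a b z2.
Proof.
move=> ab; rewrite {1}/payoff rmorphD/= mulrDl.
by apply: lerD; apply: payoff_ge; case: ifP => _; rewrite ?ab ?lexx.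
Qed.

Lemma payoffMn a b z p : payoff a b (z *+ p.+1) = payoff a b z *+ p.+1.
Proof.
by rewrite /payoff pmulrn_lgt0// rmorphMn/= mulrnAl.
Qed.

End Payoff.

(** * The functional for two bounds and a finitely supported multiplicity *)

Section IntervalSum.
Variables (R : realType) (T : choiceType).
Implicit Types (a b c : T -> R) (m : T -> int) (x y : T).

Definition fin_supp m := finite_set [set y | m y != 0].

(** [Lsum A B F] is [interval_sum A B (mult F)] by conversion; abstracting from boxes leaves a
    statement about sets of multiplicities closed under addition. *)
Definition interval_sum a b m : R :=
  \sum_(y \in [set y | 0 < m y]) (m y)%:~R * b y +
  \sum_(y \in [set y | m y < 0]) (m y)%:~R * a y.

Definition update a x (t : R) : T -> R := fun y => if y == x then t else a y.

(** The list may exceed the support, so that several multiplicities can be summed over one common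
    list. *)
Lemma interval_sumE (s : seq T) a b m :
  uniq s -> [set y | m y != 0] `<=` [set` s] ->
  interval_sum a b m = \sum_(y <- s) payoff (a y) (b y) (m y).
Proof.
move=> us ms; rewrite /interval_sum.
have -> : [set y | 0 < m y] = [set` s] `&` [set y | 0 < m y].
  by apply/seteqP; split=> y /=; [move=> h; split=> //; apply: ms => /=; rewrite gt_eqF|case].
have -> : [set y | m y < 0] = [set` s] `&` [set y | m y < 0].
  by apply/seteqP; split=> y /=; [move=> h; split=> //; apply: ms => /=; rewrite lt_eqF|case].
rewrite !fsbig_mkcondr -!fsbig_seq// -big_split/=; apply: eq_bigr => y _.
have -> : (y \in [set y | 0 < m y]) = (0 < m y) by rewrite mem_setE.
have -> : (y \in [set y | m y < 0]) = (m y < 0) by rewrite mem_setE.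
rewrite /payoff.
by case: ltgtP => [h|h|<-]; rewrite ?addr0 ?add0r// mul0r.
Qed.

Lemma fin_supp_seq m : fin_supp m ->
  exists2 s : seq T, uniq s & [set y | m y != 0] `<=` [set` s].
Proof.
move=> /finite_seqP[s ms]; exists (undup s); first exact: undup_uniq.
by rewrite ms => y /=; rewrite mem_undup.
Qed.

Lemma fin_suppD m1 m2 : fin_supp m1 -> fin_supp m2 -> fin_supp (m1 \+ m2).
Proof.
move=> f1 f2; have := conj f1 f2; rewrite -finite_setU; apply: sub_finite_set.
move=> y /=; have [->|_ _] := eqVneq (m1 y) 0; last by left.
by rewrite add0r; right.
Qed.

Lemma le_interval_sum a b a' b' m : fin_supp m ->
  (forall y, m y != 0 -> a y <= a' y /\ b' y <= b y) ->
  interval_sum a' b' m <= interval_sum a b m.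
Proof.
move=> /fin_supp_seq[s us ms] ab; rewrite !(interval_sumE _ _ us ms).
apply: ler_sum => y _; have [->|/ab[]] := eqVneq (m y) 0.
  by rewrite !payoff0.
exact: le_payoff.
Qed.

Lemma interval_sumD a b m1 m2 : (forall y, a y <= b y) ->
  fin_supp m1 -> fin_supp m2 ->
  interval_sum a b (m1 \+ m2) <= interval_sum a b m1 + interval_sum a b m2.
Proof.
move=> ab f1 f2; have := conj f1 f2.
rewrite -finite_setU => /finite_seqP[s0 es0].
have us := undup_uniq s0.
have m1s : [set y | m1 y != 0] `<=` [set` undup s0].
  by move=> y my; rewrite /= mem_undup; have : [set` s0] y by rewrite -es0; left.
have m2s : [set y | m2 y != 0] `<=` [set` undup s0].
  by move=> y my; rewrite /= mem_undup; have : [set` s0] y by rewrite -es0; right.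
rewrite (interval_sumE _ _ us m1s) (interval_sumE _ _ us m2s).
rewrite (@interval_sumE (undup s0))//; last first.
  move=> y /=; have [->|+ _] := eqVneq (m1 y) 0; last exact: m1s.
  by rewrite add0r; exact: m2s.
by rewrite -big_split/=; apply: ler_sum => y _; exact: payoffD.
Qed.

Lemma interval_sumMn a b m p : fin_supp m ->
  interval_sum a b (fun y => m y *+ p.+1) = interval_sum a b m *+ p.+1.
Proof.
move=> /fin_supp_seq[s us ms]; rewrite (interval_sumE _ _ us ms).
rewrite (interval_sumE _ _ us).
  by rewrite -sumrMnl; apply: eq_bigr => y _; rewrite payoffMn.
by move=> y /=; rewrite mulrn_eq0 => /norP[_]; exact: ms.
Qed.

Lemma interval_sum_updl a b m x t : fin_supp m ->
  interval_sum (update a x t) b m =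
  interval_sum a b m + payoff (t - a x) 0 (m x).
Proof.
move=> /fin_supp_seq[s us ms]; rewrite !(interval_sumE _ _ us ms).
have [xs|xs] := boolP (x \in s); last first.
  have -> : m x = 0 by apply/eqP; apply: contraNT xs => /ms.
  rewrite payoff0 addr0; apply: eq_big_seq => y ys.
  by rewrite /update ifN//; apply: contraNneq xs => <-.
rewrite !(bigD1_seq x)//= {1}/update eqxx (payoff_sub (a x)) addrAC.
by congr (_ + _ + _); apply: eq_bigr => y yx; rewrite /update ifN.
Qed.

Lemma interval_sum_updr a b m x t : fin_supp m ->
  interval_sum a (update b x t) m =
  interval_sum a b m + payoff 0 (t - b x) (m x).
Proof.
move=> /fin_supp_seq[s us ms]; rewrite !(interval_sumE _ _ us ms).
have [xs|xs] := boolP (x \in s); last first.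
  have -> : m x = 0 by apply/eqP; apply: contraNT xs => /ms.
  rewrite payoff0 addr0; apply: eq_big_seq => y ys.
  by rewrite /update ifN//; apply: contraNneq xs => <-.
rewrite !(bigD1_seq x)//= {1}/update eqxx (payoff_sup _ (b x)) addrAC.
by congr (_ + _ + _); apply: eq_bigr => y yx; rewrite /update ifN.
Qed.

(** * A Hahn-Banach sandwich argument by Zorn's lemma *)

Section Sandwich.
Variable M : set (T -> int).
Hypothesis MD : forall m1 m2, M m1 -> M m2 -> M (m1 \+ m2).
Hypothesis M_fin : forall m, M m -> fin_supp m.

Let MMn m p : M m -> M (fun y => m y *+ p.+1).
Proof.
move=> Mm; elim: p => [//|p IH].
have -> : (fun y => m y *+ p.+2) = m \+ (fun y => m y *+ p.+1).
  by apply/funext => y /=; rewrite mulrS.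
exact: MD.
Qed.

Definition admissible (p : (T -> R) * (T -> R)) :=
  (forall y, p.1 y <= p.2 y) /\ (forall m, M m -> 0 <= interval_sum p.1 p.2 m).

(** Going up in this preorder shrinks the intervals, so tightest bounds are maximal elements. *)
Definition refines (p q : (T -> R) * (T -> R)) :=
  forall y, p.1 y <= q.1 y /\ q.2 y <= p.2 y.

Lemma refines_trans p q r : refines p q -> refines q r -> refines p r.
Proof.
move=> pq qr y; have [p1 p2] := pq y; have [q1 q2] := qr y.
by split; [exact: le_trans p1 q1|exact: le_trans q2 p2].
Qed.

(* The one-dimensional Hahn-Banach step: an obstruction F to raising a at x and
   an obstruction G to lowering b at x have opposite signs at x, so that a
   positive combination of them vanishes at x and obstructs (a, b) itself. *)
Lemma admissible_refine a b x t : admissible (a, b) -> a x < t < b x ->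
  admissible (update a x t, b) \/ admissible (a, update b x t).
Proof.
move=> [/= ab L0] /andP[at_ tb].
apply: contrapT => /not_orP[nl nr].
have [F MF F0] : exists2 F, M F & interval_sum (update a x t) b F < 0.
  apply: contrapT => h; apply: nl; split=> /= [y|m Mm].
    by rewrite /update; case: eqP => [->|//]; exact: ltW.
  by rewrite leNgt; apply/negP => m0; apply: h; exists m.
have [G MG G0] : exists2 G, M G & interval_sum a (update b x t) G < 0.
  apply: contrapT => h; apply: nr; split=> /= [y|m Mm].
    by rewrite /update; case: eqP => [->|//]; exact: ltW.
  by rewrite leNgt; apply/negP => m0; apply: h; exists m.
(* Raising [a] at [x] changes the functional only at a negative multiplicity; dually, lowering [b]
   matters only at a positive one. *)
have Fx : F x < 0.
  rewrite ltNge; apply/negP => Fx; move: F0; rewrite ltNge => /negP; apply.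
  rewrite interval_sum_updl; last exact: M_fin.
  rewrite addr_ge0 ?L0// /payoff; case: ifPn => [|Fx']; first by rewrite mulr0.
  by have -> : F x = 0 by [apply/eqP; rewrite eq_le Fx leNgt Fx']; rewrite mul0r.
have Gx : 0 < G x.
  rewrite ltNge; apply/negP => Gx; move: G0; rewrite ltNge => /negP; apply.
  rewrite interval_sum_updr; last exact: M_fin.
  by rewrite addr_ge0 ?L0// /payoff ltNge Gx/= mulr0.
(* Each obstruction ignores the other update, so both are negative for the doubly updated pair. *)
have F0' : interval_sum (update a x t) (update b x t) F < 0.
  rewrite interval_sum_updr; last exact: M_fin.
  by rewrite /payoff (lt_gtF Fx) mulr0 addr0.
have G0' : interval_sum (update a x t) (update b x t) G < 0.
  rewrite interval_sum_updl; last exact: M_fin.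
  by rewrite /payoff Gx mulr0 addr0.
have [p Fp] : exists p : nat, F x = - (p.+1)%:Z.
  by case: (F x) Fx => // p _; exists p; rewrite NegzE.
have [q Gq] : exists q : nat, G x = (q.+1)%:Z.
  by case: (G x) Gx => [[//|q]|//] _; exists q.
(* The weights are [q.+1 = G x] for [F] and [p.+1 = - F x] for [G], which cancel at [x]. *)
have MH := MD (MMn q MF) (MMn p MG).
have := L0 _ MH; rewrite leNgt => /negP; apply.
have Hx : F x *+ q.+1 + G x *+ p.+1 = 0.
  by rewrite Fp Gq -!natz mulNrn -!mulrnA mulnC addNr.
have -> : interval_sum a b ((fun y => F y *+ q.+1) \+ (fun y => G y *+ p.+1)) =
   interval_sum (update a x t) (update b x t)
     ((fun y => F y *+ q.+1) \+ (fun y => G y *+ p.+1)).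
  rewrite interval_sum_updl; last exact: M_fin.
  rewrite interval_sum_updr; last exact: M_fin.
  by rewrite /= Hx !payoff0 !addr0.
(* Subadditivity needs ordered bounds: both equal [t] at [x], and [a <= b] elsewhere. *)
apply: le_lt_trans (interval_sumD _ _ _) _.
- by move=> y; rewrite /update; case: eqP.
- by apply: M_fin; exact: MMn.
- by apply: M_fin; exact: MMn.
by rewrite !interval_sumMn ?ltr_nDl ?pmulrn_llt0//; exact: M_fin.
Qed.

(** The bound is the pointwise supremum of lower ends with the pointwise infimum of upper ends.
    Nonnegativity survives because only the finitely many points of a support matter, and there a
    single member of the chain comes arbitrarily close. *)
Lemma admissible_chain (P : set ((T -> R) * (T -> R))) :
  P !=set0 -> P `<=` admissible ->
  (forall p q, P p -> P q -> refines p q \/ refines q p) ->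
  exists2 l, admissible l & forall p, P p -> refines p l.
Proof.
move=> [p0 Pp0] Padm Ptot.
have cross p q y : P p -> P q -> p.1 y <= q.2 y.
  move=> Pp Pq; have [pq|qp] := Ptot _ _ Pp Pq.
    by apply: le_trans (pq y).1 _; have [] := Padm _ Pq.
  by apply: le_trans (qp y).2; have [] := Padm _ Pp.
pose lo y := [set p.1 y | p in P]; pose hi y := [set p.2 y | p in P].
have lo0 y : lo y !=set0 by exists (p0.1 y), p0.
have hi0 y : hi y !=set0 by exists (p0.2 y), p0.
have lo_ub y q : P q -> ubound (lo y) (q.2 y).
  by move=> Pq _ [p Pp <-]; exact: cross.
have hi_lb y q : P q -> lbound (hi y) (q.1 y).
  by move=> Pq _ [p Pp <-]; exact: cross.
have sup_lo y : has_sup (lo y) by split=> //; exists (p0.2 y); exact: lo_ub.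
have inf_hi y : has_inf (hi y) by split=> //; exists (p0.1 y); exact: hi_lb.
pose l := (fun y => sup (lo y), fun y => inf (hi y)).
have refl_l p : P p -> refines p l.
  move=> Pp y; split.
    by apply: ub_le_sup; [exact: (sup_lo y).2|exists p].
  by apply: ge_inf; [exact: (inf_hi y).2|exists p].
exists l => //; split=> [y|m Mm].
  apply: ge_sup => // _ [p Pp <-]; apply: lb_le_inf => //; exact: hi_lb.
(* Only one end of the interval counts at [x]; it is approximated within [e] divided by the absolute
   value of [m x]. *)
have point x e : 0 < e -> exists2 p, P p &
    payoff (p.1 x) (p.2 x) (m x) <= payoff (l.1 x) (l.2 x) (m x) + e.
  move=> e0; rewrite /payoff; case: (ltgtP (m x) 0) => mx.
  - have mx' : 0 < - (m x)%:~R :> R by rewrite oppr_gt0 ltrz0.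
    have [_ [p Pp <-] h] := sup_adherent (divr_gt0 e0 mx') (sup_lo x).
    exists p => //; rewrite ltrBlDr -ltrBlDl ltr_pdivlMr// in h.
    rewrite /l/=; lra.
  - have mx' : 0 < (m x)%:~R :> R by rewrite ltr0z.
    have [_ [p Pp <-] h] := inf_adherent (divr_gt0 e0 mx') (inf_hi x).
    exists p => //; rewrite -ltrBlDl ltr_pdivlMr// in h.
    rewrite /l/=; lra.
  - by exists p0 => //; rewrite mx !mul0r add0r ltW.
have [s us ms] := fin_supp_seq (M_fin Mm).
have approx e : 0 < e -> exists2 p, P p &
    \sum_(y <- s) payoff (p.1 y) (p.2 y) (m y) <=
    \sum_(y <- s) payoff (l.1 y) (l.2 y) (m y) + e.
  elim: s e {us ms} => [|x s IH] e e0.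
    by exists p0 => //; rewrite !big_nil add0r ltW.
  have e20 : 0 < e / 2 by rewrite divr_gt0.
  have [p Pp ps] := IH _ e20; have [q Pq qx] := point x _ e20.
  have mono p' q' y : refines p' q' ->
      payoff (q'.1 y) (q'.2 y) (m y) <= payoff (p'.1 y) (p'.2 y) (m y).
    by move=> /(_ y)[]; exact: le_payoff.
  (* The finer of [p] and [q] does both jobs, since refining decreases every payoff. *)
  have [r [Pr pr qr]] : exists r, [/\ P r, refines p r & refines q r].
    by have [h|h] := Ptot _ _ Pp Pq; [exists q|exists p]; split=> // y.
  exists r => //; rewrite !big_cons.
  have := mono _ _ x qr.
  have := ler_sum s (fun y (_ : true) => mono _ _ y pr).
  lra.
rewrite (interval_sumE _ _ us ms); apply/ler_addgt0Pr => e /approx[p Pp].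
apply: le_trans; rewrite -(interval_sumE _ _ us ms).
exact: (Padm _ Pp).2.
Qed.

Lemma sandwich a b : admissible (a, b) ->
  exists c, (forall y, a y <= c y <= b y) /\
            (forall m, M m -> 0 <= interval_sum c c m).
Proof.
move=> ab.
pose S := {p | admissible p /\ refines (a, b) p}.
pose s0 : S := exist _ (a, b) (conj ab (fun y => conj (lexx _) (lexx _))).
pose rle (p q : S) := `[< refines (sval p) (sval q) >].
have [|||p pmax] := @ZL_preorder S s0 rle.
- by move=> p; apply/asboolP => y.
- move=> q p r /asboolP qp /asboolP pr; apply/asboolP.
  exact: refines_trans qp pr.
(* The empty chain is bounded by [(a, b)] itself. *)
- move=> C Ctot; have [[p0 Cp0]|C0] := pselect (C !=set0); last first.
    by exists s0 => p Cp; exfalso; apply: C0; exists p.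
  have [||p q|l ladm lref] := @admissible_chain [set sval p | p in C].
  + by exists (sval p0), p0.
  + by move=> _ [p _ <-]; exact: (svalP p).1.
  + move=> [p' Cp <-] [q' Cq <-].
    by have [/asboolP|/asboolP] := Ctot _ _ Cp Cq; [left|right].
  have l_ab : refines (a, b) l.
    by apply: refines_trans (svalP p0).2 _; apply: lref; exists p0.
  exists (exist _ l (conj ladm l_ab)) => q Cq; apply/asboolP => /=.
  by apply: lref; exists q.
case: p pmax => [[u v] [uv_adm uv_ab]] pmax.
have [uv L0] := uv_adm; rewrite /= in uv L0.
have uvE : u = v.
  apply/funext => x; apply: contrapT => /eqP uvx.
  have ltuv : u x < v x by rewrite lt_neqAle uvx uv.
  pose t := (u x + v x) / 2.
  have ut : u x < t by rewrite /t; lra.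
  have tv : t < v x by rewrite /t; lra.
  (* Maximality in a preorder: a refinement of [(u, v)] is refined back by it, which moving one end
     to the midpoint [t] contradicts. *)
  have noref q : admissible q -> refines (u, v) q -> refines q (u, v).
    move=> qadm qref.
    have q_ab := refines_trans uv_ab qref.
    have /asboolP := pmax (exist _ q (conj qadm q_ab)) (asboolT qref).
    by [].
  have [|q1|q2] := @admissible_refine u v x t uv_adm; first by rewrite ut.
  - have /(_ x)[/=] : refines (update u x t, v) (u, v).
      apply: noref => // y /=; split=> //; rewrite /update.
      by case: eqP => [->|//]; exact: ltW.
    by rewrite /update eqxx leNgt ut.
  - have /(_ x)[_ /=] : refines (u, update v x t) (u, v).
      apply: noref => // y /=; split=> //; rewrite /update.
      by case: eqP => [->|//]; exact: ltW.
    by rewrite /update eqxx leNgt tv.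
exists u; split=> [y|m Mm]; last by rewrite {2}uvE; exact: L0.
have [/= -> h] := uv_ab y; by rewrite uvE.
Qed.

End Sandwich.
End IntervalSum.

(** * Vertices, multiplicities and volumes of boxes *)

Section Boxes.
Variables (R : realType) (n : nat).
Implicit Types (b : box R n) (F : seq (box R n)) (x y v : 'rV[R]_n).
Implicit Types (f : 'rV[R]_n -> R) (k : nat) (i j : 'I_n).

Lemma finite_ver b : finite_set (ver b).
Proof.
pose g (e : {ffun 'I_n -> bool}) : 'rV[R]_n :=
  \row_i (if e i then b.1 0 i else b.2 0 i).
apply: (@sub_finite_set _ _ [set` [seq g e | e : {ffun 'I_n -> bool}]]).
  move=> v vb /=; apply/mapP; exists [ffun i => v 0 i == b.1 0 i].
    by rewrite mem_enum.
  apply/rowP => i; rewrite mxE ffunE; case: eqP => // vi.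
  by case: (vb i).
exact: finite_seq.
Qed.

Lemma cube_ver b v : cube b.1 -> cube b.2 -> ver b v -> cube v.
Proof. by move=> c1 c2 vb i; case: (vb i) => ->; [exact: c1|exact: c2]. Qed.

Lemma box_mult_ver b v : box_mult b v != 0 -> ver b v.
Proof. by rewrite /box_mult; case: asboolP => //; rewrite eqxx. Qed.

Lemma mult_cons b F : mult (b :: F) = box_mult b \+ mult F.
Proof. by apply/funext => y; rewrite /mult big_cons. Qed.

Lemma mult_cat F1 F2 : mult (F1 ++ F2) = mult F1 \+ mult F2.
Proof. by apply/funext => y; rewrite /mult big_cat. Qed.

Lemma mult_ver F y : mult F y != 0 -> exists2 b, b \in F & ver b y.
Proof.
elim: F => [|b F IH]; first by rewrite /mult big_nil eqxx.
rewrite mult_cons/=; have [->|/box_mult_ver by_ _] := eqVneq (box_mult b y) 0.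
  by rewrite add0r => /IH[c cF cy]; exists c => //; rewrite in_cons cF orbT.
by exists b => //; rewrite mem_head.
Qed.

Lemma cube_mult k F y : kbox_family k F -> mult F y != 0 -> cube y.
Proof.
by move=> kF /mult_ver[b /kF[c1 c2 _ _]]; exact: cube_ver.
Qed.

Lemma fin_supp_box_mult b : fin_supp (box_mult b).
Proof. exact: sub_finite_set (@box_mult_ver b) (finite_ver b). Qed.

Lemma fin_supp_mult F : fin_supp (mult F).
Proof.
elim: F => [|b F IH]; last first.
  by rewrite mult_cons; apply: fin_suppD => //; exact: fin_supp_box_mult.
apply: (@sub_finite_set _ _ set0) => // y /=.
by rewrite /mult big_nil eqxx.
Qed.

(** The quantity whose nonnegativity on k-boxes defines [k_increasing]. *)
Definition volume f b : R := \sum_(v \in ver b) (box_sign b v)%:~R * f v.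

Lemma volumeE (s : seq 'rV[R]_n) f b :
  uniq s -> [set y | box_mult b y != 0] `<=` [set` s] ->
  volume f b = \sum_(y <- s) (box_mult b y)%:~R * f y.
Proof.
move=> us bs; rewrite fsbig_seq// /volume.
have vers : ver b `<=` [set` s].
  move=> v bv; apply: bs => /=; rewrite /box_mult asboolT// /box_sign.
  by rewrite expf_neq0.
rewrite -[in LHS](setIidr vers) fsbig_mkcondr; apply: eq_fsbigr => y _.
rewrite /box_mult; case: asboolP => yb; first by rewrite mem_set.
by rewrite memNset// mul0r.
Qed.

(** With equal bounds the functional is linear in the multiplicity, so it splits over the boxes. *)
Lemma interval_sum_volume f F :
  interval_sum f f (mult F) = \sum_(b <- F) volume f b.
Proof.
(* The list must contain the vertices of every box, including those that cancel in [mult F]. *)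
have [s us sF] : exists2 s : seq 'rV[R]_n, uniq s &
    forall b y, b \in F -> box_mult b y != 0 -> y \in s.
  elim: F => [|b F [s us sF]]; first by exists [::].
  have [t ut bt] := fin_supp_seq (fin_supp_box_mult b).
  exists (undup (s ++ t)) => [|c y]; first exact: undup_uniq.
  rewrite mem_undup mem_cat in_cons => /predU1P[->|cF] cy.
    by rewrite (bt _ cy) orbT.
  by rewrite (sF _ _ cF cy).
rewrite (interval_sumE _ _ us); last first.
  move=> y /= Fy; have [s0|ys] := boolP (y \in s) => //.
  move: Fy; rewrite /mult big_seq big1 ?eqxx// => b bF.
  by apply/eqP; apply: contraNT ys => /sF; exact.
transitivity (\sum_(y <- s) \sum_(b <- F) (box_mult b y)%:~R * f y).
  apply: eq_bigr => y _; rewrite /payoff if_same /mult rmorph_sum/=.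
  by rewrite mulr_suml.
rewrite exchange_big/=; apply: eq_big_seq => b bF.
by rewrite -volumeE// => y; exact: sF.
Qed.

(** Every degenerate coordinate of a vertex agrees with the lower corner, and [n - box_dim b] counts
    exactly these. *)
Lemma box_signE b v : ver b v -> (forall i, b.1 0 i <= b.2 0 i) ->
  box_sign b v = (-1) ^+ #|[set i | (b.1 0 i < b.2 0 i) && (v 0 i == b.1 0 i)]%SET|.
Proof.
move=> vb le12; rewrite /box_sign; congr (_ ^+ _).
set P := [set i | b.1 0 i < b.2 0 i]%SET.
set Q := [set i | v 0 i == b.1 0 i]%SET.
have cP : (n - box_dim b)%N = #|~: P|.
  by rewrite /box_dim -/P -[X in (X - _)%N](card_ord n) -(cardsC P) addKn.
have -> : [set i | (b.1 0 i < b.2 0 i) && (v 0 i == b.1 0 i)]%SET = Q :&: P.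
  by apply/setP => i; rewrite !inE andbC.
rewrite cP -(cardsID P Q).
suff -> : (Q :\: P)%SET = (~: P)%SET by rewrite addnK.
apply/setP => i; rewrite !inE; case: ltP => //= le21.
have e : b.1 0 i = b.2 0 i by apply/eqP; rewrite eq_le le12.
by case: (vb i) => ->; rewrite ?e eqxx.
Qed.

(** * Thickening an edge to a box of higher dimension *)

Section Thicken.
Variables (b : box R n) (i : 'I_n) (I : {set 'I_n}).
Hypotheses (b1 : cube b.1) (b2 : cube b.2) (lti : b.1 0 i < b.2 0 i).
Hypothesis bj : forall j, j != i -> b.1 0 j = b.2 0 j /\ 0 < b.2 0 j.
Hypothesis iI : i \in I.

(** [b] is an edge in direction [i], and [I] is the set of directions that are to be
    nondegenerate. *)
Definition thicken : box R n :=
  (\row_j (if (j \in I) && (j != i) then 0 else b.1 0 j), b.2).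

Let le12 j : b.1 0 j <= b.2 0 j.
Proof. by have [->|/bj[->]] := eqVneq j i; rewrite ?lexx ?ltW. Qed.

Let thicken_lt j : (thicken.1 0 j < thicken.2 0 j) = (j \in I).
Proof.
rewrite mxE/=; have [->|ji] := eqVneq j i; first by rewrite andbF lti iI.
have [e lt0] := bj ji; rewrite andbT; case: ifP => _ //.
by rewrite e ltxx.
Qed.

Lemma thicken_kbox : is_kbox #|I| thicken.
Proof.
split=> //.
- move=> j; rewrite mxE; case: ifP => _; last exact: b1.
  by rewrite in_itv/= lexx ler01.
- move=> j; rewrite mxE; case: ifP => // _.
  by have := b2 j; rewrite in_itv/= => /andP[].
- by rewrite /box_dim; apply: eq_card => j; rewrite inE thicken_lt.
Qed.

Lemma ver_thicken v : ver b v -> ver thicken v.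
Proof.
move=> vb j; rewrite mxE /=; case: ifP => [/andP[_ ji]|_]; last exact: vb.
by right; case: (vb j) => -> //; have [] := bj ji.
Qed.

(** On each new side a vertex of [b] sits at the upper, positive end, which does not enter the
    sign. *)
Lemma sign_thicken v : ver b v -> box_sign thicken v = box_sign b v.
Proof.
move=> vb; rewrite !box_signE//; last 2 first.
- exact: ver_thicken.
- by have [] := thicken_kbox.
congr (_ ^+ _); apply: eq_card => j; rewrite !inE thicken_lt mxE.
have [->|ji] := eqVneq j i; first by rewrite andbF iI lti.
have [e lt0] := bj ji; rewrite e ltxx/= andbT.
case: ifP => //= jI; apply/negbTE.
by case: (vb j) => ->; rewrite ?e gt_eqF.
Qed.

Lemma ver_thicken_zero v : ver thicken v -> ~ ver b v -> exists j, v 0 j = 0.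
Proof.
move=> vt; apply: contra_notP => v0 j.
have := vt j; rewrite mxE/=; case: ifP => // _ [vj|]; last by right.
by exfalso; apply: v0; exists j.
Qed.

End Thicken.

Lemma exists_card_set i k : (1 <= k <= n)%N ->
  exists2 I : {set 'I_n}, i \in I & #|I| = k.
Proof.
move=> /andP[k1 kn].
pose s := take k (i :: rem i (enum 'I_n)).
have us : uniq s.
  apply: take_uniq; rewrite /= mem_rem_uniq ?enum_uniq// inE eqxx/=.
  by rewrite rem_uniq ?enum_uniq.
exists [set j in s]%SET; first by rewrite inE /s; case: (k) k1 => // k' _; rewrite mem_head.
rewrite cardsE (card_uniqP us) size_takel//=.
rewrite size_rem ?mem_enum// size_enum_ord; lia.
Qed.

(** The edge has the same volume as its thickening, as the extra vertices have a zero coordinate. *)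
Lemma grounded_k_increasing_1 k f : (1 <= k <= n)%N ->
  grounded f -> k_increasing k f -> k_increasing 1 f.
Proof.
move=> kn f0 fk b [b1 b2 le12 /eqP/cards1P[i Pi]].
have lti : b.1 0 i < b.2 0 i.
  by have := finset.set11 i; rewrite -Pi inE.
have bE j : j != i -> b.1 0 j = b.2 0 j.
  move=> ji; have := finset.in_set1 j i; rewrite (negbTE ji) -Pi inE => /negbT.
  by rewrite -leNgt => h; apply/eqP; rewrite eq_le le12.
(* A fixed coordinate equal to 0 cannot be thickened, but then [f] vanishes at all vertices of
   [b]. *)
have [[j ji bj0]|b_pos] := pselect (exists2 j, j != i & b.2 0 j = 0).
  rewrite fsbig1// => v vb; rewrite f0 ?mulr0//; first exact: cube_ver vb.
  by exists j; case: (vb j) => ->; rewrite ?bE.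
have bj j : j != i -> b.1 0 j = b.2 0 j /\ 0 < b.2 0 j.
  move=> ji; split; first exact: bE.
  have := b2 j; rewrite in_itv/= => /andP[h _]; rewrite lt_neqAle h andbT.
  by apply/eqP => e; apply: b_pos; exists j.
have [I iI Ik] := exists_card_set i kn.
have tk := thicken_kbox b1 b2 lti bj iI.
rewrite Ik in tk; have := fk _ tk.
have vt : ver b `<=` ver (thicken b i I) by move=> v; exact: ver_thicken.
rewrite -(@fsbig_widen _ _ _ _ _ _ _ vt); last first.
  move=> v [vt' vb] /=; have [c1 c2 _ _] := tk.
  rewrite f0 ?mulr0//; first exact: cube_ver vt'.
  exact: ver_thicken_zero vt' vb.
congr (_ <= _); apply: eq_fsbigr => v; rewrite inE => vb.
by rewrite (sign_thicken _ _ lti bj iI).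
Qed.

(** The edge from [x] up to 1 in direction [i] gives its lower end [x] the sign -1, and thickening
    keeps it. *)
Lemma exists_neg_mult k x i : (1 <= k <= n)%N -> cube x ->
  (forall j, 0 < x 0 j) -> x 0 i < 1 ->
  exists2 b, is_kbox k b & box_mult b x < 0.
Proof.
move=> kn cx x0 xi.
pose b : box R n := (x, set_coord x i 1).
have b2 : cube b.2.
  by move=> j; rewrite mxE; case: eqP => // _; rewrite in_itv/= ler01 lexx.
have lti : b.1 0 i < b.2 0 i by rewrite mxE eqxx.
have bj j : j != i -> b.1 0 j = b.2 0 j /\ 0 < b.2 0 j.
  by move=> ji; rewrite mxE (negbTE ji).
have [I iI Ik] := exists_card_set i kn.
exists (thicken b i I); first by rewrite -Ik; exact: thicken_kbox.
have xb : ver b x by move=> j; left.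
rewrite /box_mult asboolT; last exact: ver_thicken.
rewrite (sign_thicken (b := b) cx b2 lti bj iI xb) box_signE//; last first.
  by move=> j; have [->|/bj[->]] := eqVneq j i; rewrite ?lexx ?ltW.
rewrite (_ : [set _ | _]%SET = [set i]%SET) ?cards1//.
apply/setP => j; rewrite !inE eqxx andbT.
by have [->|/bj[->]] := eqVneq j i; rewrite ?ltxx ?lti.
Qed.

End Boxes.

(** * Standardized bounds, interpolation and the infimum [PO] *)

Section Bounds.
Variables (R : realType) (n k : nat) (A B : 'rV[R]_n -> R).
Hypothesis kn : (1 <= k <= n)%N.
Hypotheses (A_std : standardized A) (B_std : standardized B).
Hypothesis leAB : le_on_cube A B.
Implicit Types (C : 'rV[R]_n -> R) (x : 'rV[R]_n) (F : seq (box R n)).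

Lemma between_standardized C : le_on_cube A C -> le_on_cube C B ->
  k_increasing k C -> unit_valued C /\ standardized C.
Proof.
move=> leAC leCB kC; have [A01 A0 _ A1] := A_std; have [B01 B0 _ B1] := B_std.
have C01 : unit_valued C.
  move=> x cx; have := A01 _ cx; have := B01 _ cx; rewrite !in_itv/=.
  move=> /andP[_ Bx1] /andP[Ax0 _].
  by rewrite (le_trans Ax0 (leAC _ cx)) (le_trans (leCB _ cx) Bx1).
have C0 : grounded C.
  move=> x cx x0; apply/eqP; rewrite eq_le.
  by have := leAC _ cx; have := leCB _ cx; rewrite (A0 _ cx x0) (B0 _ cx x0) => -> ->.
split=> //; split=> //; first exact: grounded_k_increasing_1 C0 kC.
have c1 : cube (const_mx 1 : 'rV[R]_n).
  by move=> i; rewrite mxE in_itv/= ler01 lexx.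
by apply/eqP; rewrite eq_le; have := leAC _ c1; have := leCB _ c1; rewrite A1 B1 => -> ->.
Qed.

(** [C] lies between the updated bounds on the cube, so the functional dominates a sum of volumes of
    [C]. *)
Lemma update_interval_sum_ge0 C x F : le_on_cube A C -> le_on_cube C B ->
  k_increasing k C -> kbox_family k F ->
  0 <= interval_sum (update A x (C x)) B (mult F).
Proof.
move=> leAC leCB kC kF.
have C0 : 0 <= interval_sum C C (mult F).
  rewrite interval_sum_volume big_seq; apply: sumr_ge0 => b /kF; exact: kC.
apply: le_trans C0 _; apply: le_interval_sum; first exact: fin_supp_mult.
move=> y /(cube_mult kF) cy; split; last exact: leCB.
by rewrite /update; case: eqP => [->//|_]; exact: leAC.
Qed.

(** This keeps the convention for an empty infimum harmless: without a negative family at [x], the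
    gap [B x - A x] is 0. *)
Lemma eq_or_neg_family x : cube x ->
  A x = B x \/ exists2 F, kbox_family k F & mult F x < 0.
Proof.
move=> cx; have [A01 A0 _ A1] := A_std; have [B01 B0 _ B1] := B_std.
have [x0|x0] := pselect (exists i, x 0 i = 0); first by left; rewrite A0 ?B0.
have [x1|x1] := pselect (forall i, x 0 i = 1).
  by left; rewrite (_ : x = const_mx 1) ?A1 ?B1//; apply/rowP => i; rewrite mxE.
right; move/existsNP : x1 => [i /eqP xi].
have x_pos j : 0 < x 0 j.
  have := cx j; rewrite in_itv/= => /andP[h _]; rewrite lt_neqAle h andbT.
  by apply/eqP => e; apply: x0; exists j.
have xi1 : x 0 i < 1.
  by have := cx i; rewrite in_itv/= => /andP[_ h]; rewrite lt_neqAle xi h.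
have [b kb bx] := exists_neg_mult kn cx x_pos xi1.
exists [:: b]; first by move=> c; rewrite inE => /eqP ->.
by rewrite /mult big_seq1.
Qed.

Lemma interpolation x : cube x ->
  (forall F, kbox_family k F -> 0 <= interval_sum (update A x (B x)) B (mult F)) ->
  exists C, [/\ le_on_cube A C, le_on_cube C B, k_increasing k C & C x = B x].
Proof.
move=> cx L0.
pose a := update A x (B x).
(* Outside the cube A <= B may fail. *)
pose b y := if `[< cube y >] then B y else a y.
have Aa y : cube y -> A y <= a y.
  by rewrite /a /update; case: eqP => [->|_ _]; [exact: leAB|exact: lexx].
have bB y : cube y -> b y = B y by move=> cy; rewrite /b asboolT.
have ab y : a y <= b y.
  rewrite /b; case: asboolP => // cy; rewrite /a /update.
  by case: eqP => [->//|_]; exact: leAB.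
(* Closed under addition, because concatenating families adds multiplicities. *)
pose M := [set mult F | F in @kbox_family R n k].
have [|||C [aCb C0]] := @sandwich R _ M _ _ a b.
- move=> _ _ [F1 k1 <-] [F2 k2 <-]; exists (F1 ++ F2); last exact: mult_cat.
  by move=> c; rewrite mem_cat => /orP[/k1|/k2].
- by move=> _ [F _ <-]; exact: fin_supp_mult.
- split=> // _ [F kF <-]; apply: le_trans (L0 _ kF) _.
  apply: le_interval_sum; first exact: fin_supp_mult.
  by move=> y /(cube_mult kF) cy /=; rewrite bB.
exists C; split.
- by move=> y cy; have /andP[+ _] := aCb y; apply: le_trans; exact: Aa.
- by move=> y cy; have /andP[_] := aCb y; rewrite bB.
(* A single k-box is itself a family, and its functional with both bounds [C] is its volume. *)
- move=> c kc; rewrite -/(volume C c) -(big_seq1 +%R c (volume C)).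
  rewrite -interval_sum_volume; apply: C0; exists [:: c] => // d.
  by rewrite inE => /eqP ->.
- apply/eqP; rewrite eq_le; have := aCb x; rewrite bB// /a /update eqxx.
  by rewrite andbC.
Qed.

(** For [m = mult F x < 0], the bound [t <= L / |m|] reads [L + m * t >= 0], the functional after
    raising [A x] by [t]. Other families do not feel the raise. *)
Lemma PO_geP x t :
  (forall F, kbox_family k F -> 0 <= Lsum A B F) ->
  (exists2 F, kbox_family k F & mult F x < 0) ->
  t <= PO k A B x <->
  forall F, kbox_family k F -> 0 <= interval_sum (update A x (A x + t)) B (mult F).
Proof.
move=> L0 [F0 kF0 F0x].
have key F : mult F x < 0 ->
    (t <= Lsum A B F / `|mult F x|%:~R) =
    (0 <= interval_sum (update A x (A x + t)) B (mult F)).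
  move=> Fx; have Fx' : (mult F x)%:~R < 0 :> R by rewrite ltrz0.
  rewrite ltr0_norm// mulrNz ler_pdivlMr ?oppr_gt0//.
  rewrite interval_sum_updl; last exact: fin_supp_mult.
  rewrite /payoff (lt_gtF Fx) [A x + t]addrC addrK.
  by rewrite -subr_ge0 mulrN opprK (mulrC t).
split=> [tPO F kF|h].
  have [Fx|Fx] := ltP (mult F x) 0.
    rewrite -key//; apply: le_trans tPO _; apply: ge_inf; last by exists F.
    (* The lower bound 0 makes [inf] a genuine infimum. *)
    exists 0 => _ [G [kG Gx] <-]; rewrite divr_ge0 ?L0// ler0z.
  rewrite interval_sum_updl; last exact: fin_supp_mult.
  rewrite addr_ge0 ?L0// /payoff; case: ifPn => [|Fx']; first by rewrite mulr0.
  by have -> : mult F x = 0 by [apply/eqP; rewrite eq_le Fx leNgt Fx']; rewrite mul0r.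
apply: lb_le_inf; first by eexists; exists F0.
by move=> _ [F [kF Fx] <-]; rewrite key//; exact: h.
Qed.

End Bounds.

(** * Equivalence of the gap condition and attainment of the upper bound *)

Theorem theorem8p1 (R : realType) (n k : nat) (A B : 'rV[R]_n -> R)
  (n_gt0 : (0 < n)%N) (k_bounds : (1 <= k <= n)%N)
  (A_std : standardized A) (B_std : standardized B)
  (leAB : le_on_cube A B)
  (condS : conditionS A \/ conditionS B)
  (L_ge0 : forall F : seq (box R n), kbox_family k F -> 0 <= Lsum A B F) :
  (forall x : 'rV[R]_n, cube x -> PO k A B x >= B x - A x) <->
  (forall x : 'rV[R]_n, cube x ->
     B x = sup [set C x | C in [set C : 'rV[R]_n -> R |
       [/\ unit_valued C, le_on_cube A C, le_on_cube C B,
           k_increasing k C & standardized C]]]).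
Proof.
split=> [PO_ge x cx|B_sup x cx].
  have [C [leAC leCB kC Cx]] : exists C, [/\ le_on_cube A C, le_on_cube C B,
      k_increasing k C & C x = B x].
    apply: interpolation => // F kF.
    have [ABx|neg] := eq_or_neg_family k_bounds A_std B_std cx.
      rewrite interval_sum_updl; last exact: fin_supp_mult.
      by rewrite -ABx subrr /payoff if_same mulr0 addr0; exact: L_ge0.
    have := PO_ge _ cx; rewrite PO_geP//.
    by rewrite addrC subrK; apply.
  have [C01 C_std] := between_standardized k_bounds A_std B_std leAC leCB kC.
  set D := [set _ | _ in _].
  have D_ub : ubound D (B x) by move=> _ [E [_ _ EB _ _] <-]; exact: EB.
  (* The supremum is attained, by the interpolating function at [x]. *)
  have DB : D (B x) by exists C.
  apply/eqP; rewrite eq_le ge_sup//; last by exists (B x).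
  by rewrite andbT; apply: ub_le_sup => //; exists (B x).
have [ABx|neg] := eq_or_neg_family k_bounds A_std B_std cx.
  rewrite ABx subrr /PO; set D := [set _ | _ in _].
  have [->|/set0P D0] := eqVneq D set0; first by rewrite inf0.
  apply: lb_le_inf => // _ [G [kG Gx] <-]; rewrite divr_ge0 ?L_ge0// ler0z.
move: B_sup; set Cs := [set C | _] => B_sup.
(* Otherwise the supremum at the all-ones vector would be the default 0, whereas [B] is 1 there. *)
have Cs0 : Cs !=set0.
  apply/set0P/eqP => Cs0; have [_ _ _ B1] := B_std.
  have c1 : cube (const_mx 1 : 'rV[R]_n).
    by move=> i; rewrite mxE in_itv/= ler01 lexx.
  by have := B_sup _ c1; rewrite Cs0 image_set0 sup0 B1 => /eqP; rewrite oner_eq0.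
rewrite lerBlDr (B_sup _ cx); apply: ge_sup.
  by have [C CsC] := Cs0; exists (C x), C.
(* With [t = C x - A x], the raised lower bound at [x] is [C x]. *)
move=> _ [C [_ leAC leCB kC _] <-]; rewrite -lerBlDr PO_geP// => F kF.
by rewrite addrC subrK; apply: (update_interval_sum_ge0 (k := k)).
Qed.
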